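(* For any $d$-dimensional normed space $X^d$ and any positive integer $k$, $f(k,X^d)\leq (k+1)^{5^{d+\mathrm{o}(d)}}$.
   Context: All normed spaces are real. A subset $S$ of a finite-dimensional normed space $X$ is a $k$-distance set if $|\{\|x-y\| : x,y\in S,\ x\neq y\}|\leq k$. Define $f(k,X)=\max\{|S| : S \text{ is a } k\text{-distance subset of } X\}$. The term $\mathrm{o}(d)$ denotes a function of $d$ only (independent of the normed space $X^d$ and of $k$) whose ratio to $d$ tends to $0$ as $d\to\infty$. *)

(* Defs.v *)
From HB Require Import structures.
From mathcomp Require Import all_boot all_order all_algebra.
From mathcomp Require Import all_classical all_reals all_analysis.

Set Implicit Arguments.
Unset Strict Implicit.
Unset Printing Implicit Defensive.

Import Order.TTheory GRing.Theory Num.Theory.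
Import numFieldNormedType.Exports.

Local Open Scope classical_set_scope.
Local Open Scope card_scope.
Local Open Scope ring_scope.

#[short(type="normedVectType")]
HB.structure Definition NormedVector (R : numFieldType) :=
  {X of NormedModule R X & Vector R X}.

Definition distances (R : numDomainType) (X : normedZmodType R) (S : set X) :
  set R := [set r | exists x y, [/\ S x, S y, x <> y & r = `|x - y|]].

(* `A #<= `I_k` says that A is finite with at most k elements. *)
Definition k_distance_set (R : numDomainType) (X : normedZmodType R) (k : nat)
  (S : set X) : Prop := distances S #<= `I_k.

(* f(k, X) = m.  The second conjunct also forces every k-distance set to be
   finite, so this holds for some m exactly when the maximum exists. *)
Definition is_max_k_distance (R : numDomainType) (X : normedZmodType R)
  (k m : nat) : Prop :=
  (exists S : set X, k_distance_set k S /\ S #= `I_m) /\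
  (forall S : set X, k_distance_set k S -> S #<= `I_m).

(* Main.v *)
(* Cover the unit sphere by N balls of radius l < 1/4 with centres
   p_i.  Inside the cone {v : |v - s p_i| <= l s for some s > 0}, adding a
   vector strictly increases the norm, so the largest distance from x to a point
   of S lying behind x in direction i is strictly increasing along direction i.
   It takes at most k + 1 values, and the N values together determine x; hence
   |S| <= (k + 1) ^ N.

   The bound N <= 5 ^ (d + o(d)) follows Rogers' covering argument: a greedy
   choice among translates of a ball of radius mu close to 1/4 covers an
   eps-net of size tau with about ((1 + mu) / mu) ^ d * ln tau balls.  Volume is
   replaced by the number of points of the integer lattice of a basis in a ball:
   this count grows at most like r ^ d, hence at some arbitrarily large scale it
   grows by a factor at most 2 q ^ d under dilation by q, and each covering
   or packing bound needs only one such ratio, at one scale. *)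
Require Import Defs.
From mathcomp Require Import all_boot all_order all_algebra.
From mathcomp Require Import finmap ring lra zify.
From mathcomp Require Import all_classical all_reals all_analysis.

Set Implicit Arguments.
Unset Strict Implicit.
Unset Printing Implicit Defensive.

Import Order.TTheory GRing.Theory Num.Theory.
Import numFieldNormedType.Exports.

Local Open Scope classical_set_scope.
Local Open Scope ring_scope.

(** * Heights along cones *)

Definition near_ray (R : realType) (X : normedModType R) (l : R) (p v : X) :=
  exists2 s : R, 0 < s & `|v - s *: p| <= l * s.

(** Scaling [u] by [t / s] gives a vector within [2 l t] of [v], both being close to [t *: p]. Since
    [|u| >= s (1 - 2 l)], adding [v] gains at least [t (1 - 2 l) - 2 l t = t (1 - 4 l)], which is
    positive. *)
Lemma near_ray_norm_add (R : realType) (X : normedModType R) (l : R)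
    (p u v : X) :
  l < 4^-1 -> 1 - l <= `|p| -> near_ray l p u -> near_ray l p v ->
  `|u| < `|u + v|.
Proof.
move=> l4 lp [s s0 us] [t t0 vt].
have ts0 : 0 < t / s by rewrite divr_gt0.
have E : (1 + t / s) *: u = (u + v) - ((v - t *: p) - (t / s) *: (u - s *: p)).
  rewrite scalerBr scalerA divfK ?gt_eqF// scalerDl scale1r.
  by rewrite !opprB subrKA addrA addrAC addrK.
have H : (1 + t / s) * `|u| <= `|u + v| + (l * t + (t / s) * (l * s)).
  rewrite -[X in X * _]ger0_norm ?addr_ge0 ?(ltW ts0)//.
  rewrite -normrZ E; apply: (le_trans (ler_normB _ _)).
  rewrite lerD2l; apply: (le_trans (ler_normB _ _)).
  rewrite lerD// normrZ gtr0_norm// ler_pM2l//.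
have U : s * (1 - l) - l * s <= `|u|.
  have : `|s *: p| <= `|u| + `|u - s *: p|.
    by rewrite -{1}[s *: p](subKr u) ler_normB.
  rewrite normrZ gtr0_norm// => H1.
  have : s * (1 - l) <= s * `|p| by rewrite ler_pM2l.
  lra.
have U2 : t * (1 - l) - l * t <= t / s * `|u|.
  have -> : t * (1 - l) - l * t = t / s * (s * (1 - l) - l * s).
    by field; rewrite gt_eqF.
  by rewrite ler_pM2l.
have E2 : t / s * (l * s) = l * t by field; rewrite gt_eqF.
have : 0 < t * (1 - 4 * l) by rewrite mulr_gt0//; lra.
move: H U2; rewrite E2; lra.
Qed.

Section Height.
Variables (R : realType) (X : normedModType R) (S : seq X) (l : R) (p : X).

Let below x : pred X := fun z => (z \in S) && `[< near_ray l p (x - z) >].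

(** The default 0 of an empty maximum lies below every distance between distinct points and counts
    as one more value: hence [k + 1] rather than [k]. *)
Definition height (x : X) : R :=
  \big[Num.max/0]_(z <- S | below x z) `|x - z|.

Lemma height_mem (D : seq R) x : x \in S ->
  (forall y z, y \in S -> z \in S -> y != z -> `|y - z| \in D) ->
  height x \in 0 :: D.
Proof.
move=> xS dD; rewrite /height; elim/big_ind: _ => [|a b aD bD|z /andP[zS _]].
- exact: mem_head.
- by rewrite maxEle; case: ifP.
(* No lower bound on the norm of [p] is assumed here, so [x] may lie below itself; it then
   contributes 0. *)
- have [->|xz] := eqVneq x z; first by rewrite subrr normr0 mem_head.
  by rewrite inE dD ?orbT.
Qed.

(** The cone is closed under addition, so each point below [x] is below [y], and strictly farther
    from [y] by [near_ray_norm_add]. The point [x] itself is below [y], which beats the default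
    0. *)
Lemma height_lt x y : l < 4^-1 -> 1 - l <= `|p| -> x \in S -> x != y ->
  near_ray l p (y - x) -> height x < height y.
Proof.
move=> l4 lp xS xy xyp.
have yx : `|y - x| <= height y.
  apply: (le_bigmax_seq 0 x (below y) (fun z => `|y - z|)) => //.
  by rewrite /below xS; exact/asboolP.
apply: bigmax_lt => [|z /andP[zS /asboolP xz]].
  by apply: lt_le_trans yx; rewrite normr_gt0 subr_eq0 eq_sym.
apply: (@lt_le_trans _ _ `|y - z|).
  have -> : y - z = (x - z) + (y - x) by rewrite [RHS]addrC subrKA.
  exact: near_ray_norm_add l4 lp xz xyp.
apply: (le_bigmax_seq 0 z (below y) (fun z => `|y - z|)) => //.
rewrite /below zS; apply/asboolP.
have [s s0 hs] := xyp; have [t t0 ht] := xz.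
exists (s + t); first exact: addr_gt0.
have -> : y - z - (s + t) *: p = (y - x - s *: p) + (x - z - t *: p).
  by rewrite scalerDl opprD [RHS]addrACA subrKA.
by rewrite mulrDr (le_trans (ler_normD _ _))// lerD.
Qed.

End Height.

(** For distinct [x] and [y] the direction of [y - x] is close to some [p i], and the heights along
    [p i] differ. So the vector of heights, encoded by indices in [0 :: D], is injective on [S]. *)
Lemma k_distance_seq_size (R : realType) (X : normedModType R) (k N : nat)
    (l : R) (p : 'I_N -> X) (S : seq X) (D : seq R) :
  l < 4^-1 -> (forall u : X, `|u| = 1 -> exists i, `|u - p i| <= l) ->
  (size D <= k)%N -> uniq S ->
  (forall x y, x \in S -> y \in S -> x != y -> `|x - y| \in D) ->
  (size S <= k.+1 ^ N)%N.
Proof.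
move=> l4 cov Dk uS dD.
pose h (x : X) : {ffun 'I_N -> 'I_k.+1} :=
  [ffun i => inord (index (height S l (p i) x) (0 :: D))].
have hval x i : x \in S -> nth 0 (0 :: D) (h x i) = height S l (p i) x.
  move=> xS; have hx := @height_mem _ _ S l (p i) D x xS dD.
  by rewrite ffunE inordK ?nth_index// ltnS (leq_trans _ Dk)// -ltnS index_mem.
have inj : {in S &, injective h}.
  move=> x y xS yS hxy; apply/eqP; apply: contrapT => /negP xy.
  have nyx : `|y - x| != 0 by rewrite normr_eq0 subr_eq0 eq_sym.
  have nyx0 : 0 < `|y - x| by rewrite lt_def nyx normr_ge0.
  pose w := `|y - x|^-1 *: (y - x).
  have w1 : `|w| = 1 by rewrite normrZ normfV normr_id mulVf.
  have [i hi] := cov _ w1.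
  suff : height S l (p i) x < height S l (p i) y by rewrite -!hval// hxy ltxx.
  apply: height_lt => //.
    (* A centre within [l] of a unit vector has norm at least [1 - l]; other centres are never
       selected. *)
    rewrite -w1 lerBlDr; apply: le_trans (lerD (lexx _) hi).
    by apply: le_trans (ler_normD _ _); rewrite subrKC.
  exists `|y - x| => //.
  have -> : y - x - `|y - x| *: p i = `|y - x| *: (w - p i).
    by rewrite scalerBr scalerA mulfV// scale1r.
  by rewrite normrZ normr_id mulrC ler_pM2r.
have <- : #|{ffun 'I_N -> 'I_k.+1}| = (k.+1 ^ N)%N.
  by rewrite card_ffun !card_ord.
by rewrite -(size_map h) -(card_uniqP _) ?map_inj_in_uniq// max_card.
Qed.

(** * Greedy coverings *)

Lemma sum_const_seq (T : Type) (s : seq T) (m : nat) :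
  (\sum_(i <- s) m = size s * m)%N.
Proof. by rewrite big_const_seq count_predT iter_addn_0 mulnC. Qed.

(** Double counting: each [t] is missed by at most [size us - c] candidates, so some candidate
    misses no more than the average number of [t]. *)
Lemma greedy_step (T U : eqType) (ts : seq T) (us : seq U)
    (cov : T -> U -> bool) (c : nat) :
  (forall t, t \in ts -> (c <= count (cov t) us)%N) -> (0 < size us)%N ->
  exists2 p, p \in us & (count (fun t => ~~ cov t p) ts * size us
                           <= size ts * (size us - c))%N.
Proof.
move=> hc us0; set B := (size ts * _)%N; apply: contrapT => H.
have {}H p : p \in us -> (B < count (fun t => ~~ cov t p) ts * size us)%N.
  by move=> pus; rewrite ltnNge; apply/negP => K; apply: H; exists p.
have sum_le : (\sum_(p <- us) count (fun t => ~~ cov t p) ts <= B)%N.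
  under eq_bigr do rewrite -sum1_count big_mkcond.
  rewrite exchange_big/= /B -sum_const_seq big_seq [leqRHS]big_seq.
  apply: leq_sum => t tts; rewrite -big_mkcond sum1_count.
  rewrite (eq_count (_ : _ =1 predC (cov t)))// -(count_predC (cov t)).
  by rewrite leq_subRL ?leq_add2r ?hc// (leq_trans (hc _ tts)) ?leq_addr.
have : (\sum_(p <- us) B.+1 <=
    \sum_(p <- us) count (fun t => ~~ cov t p) ts * size us)%N.
  by rewrite big_seq [leqRHS]big_seq; apply: leq_sum => p /H.
rewrite -big_distrl/= sum_const_seq mulnC leq_pmul2r// => /leq_trans/(_ sum_le).
by rewrite ltnn.
Qed.

(** Each greedy choice multiplies the uncovered part by at most [1 - c / size us]; the bound is kept
    free of division. *)
Lemma greedy_cover_count (T U : eqType) (ts : seq T) (us : seq U)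
    (cov : T -> U -> bool) (c n : nat) :
  (forall t, t \in ts -> (c <= count (cov t) us)%N) ->
  exists2 Q : seq U, (size Q <= n)%N &
    (count (fun t => ~~ has (cov t) Q) ts * size us ^ n
      <= size ts * (size us - c) ^ n)%N.
Proof.
move=> hc; elim: n => [|n [Q sQ IH]].
  by exists [::] => //; rewrite !expn0 !muln1 count_size.
have [us0|us0] := posnP (size us).
  by exists [::] => //; rewrite us0 exp0n// muln0.
set left := [seq t <- ts | ~~ has (cov t) Q].
have [|p pus hp] := @greedy_step _ _ left us cov c _ us0.
  by move=> t; rewrite mem_filter => /andP[_ /hc].
exists (p :: Q) => //.
have -> : count (fun t => ~~ has (cov t) (p :: Q)) ts =
    count (fun t => ~~ cov t p) left.
  by rewrite count_filter; apply: eq_count => t /=; rewrite negb_or.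
rewrite expnS mulnA (leq_trans (leq_mul hp (leqnn _)))//.
rewrite mulnAC size_filter (leq_trans (leq_mul IH (leqnn _)))//.
by rewrite -mulnA -expnSr.
Qed.

(** By [1 - x <= exp (- x)], at most [tau * exp (- n / rho) < 1] points stay uncovered after [n]
    choices, hence none. *)
Lemma greedy_cover (R : realType) (T U : eqType) (ts : seq T) (us : seq U)
    (cov : T -> U -> bool) (c n : nat) (rho tau : R) :
  (0 < c)%N -> (forall t, t \in ts -> (c <= count (cov t) us)%N) ->
  0 < rho -> (size us)%:R <= rho * c%:R -> (size ts)%:R <= tau ->
  rho * ln tau < n%:R ->
  exists2 Q : seq U, (size Q <= n)%N & forall t, t \in ts -> has (cov t) Q.
Proof.
move=> c0 hc rho0 hus hts hn; have [Q sQ hQ] := greedy_cover_count n hc.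
exists Q => // t tts; apply: contraT => nt.
have cus : (c <= size us)%N by rewrite (leq_trans (hc _ tts))// count_size.
have us0 : 0 < (size us)%:R :> R by rewrite ltr0n (leq_trans c0).
have tau0 : 0 < tau.
  by apply: lt_le_trans hts; rewrite ltr0n; case: (ts) tts.
have : (1 * size us ^ n <= size ts * (size us - c) ^ n)%N.
  apply: leq_trans hQ; apply: leq_mul => //; rewrite -has_count.
  by apply/hasP; exists t.
rewrite mul1n -(ler_nat R) natrM !natrX natrB// => H.
have H2 : 1 <= tau * (1 - c%:R / (size us)%:R) ^+ n.
  have -> : 1 - c%:R / (size us)%:R = ((size us)%:R - c%:R) / (size us)%:R :> R.
    by field; rewrite gt_eqF.
  rewrite expr_div_n mulrA ler_pdivlMr ?exprn_gt0// mul1r (le_trans H)//.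
  by rewrite ler_wpM2r// exprn_ge0// subr_ge0 ler_nat.
have H3 : (1 - c%:R / (size us)%:R) ^+ n <= expR (- (n%:R / rho)).
  rewrite -(mulrN n%:R) expRM_natl; apply: lerXn2r.
  - by rewrite nnegrE subr_ge0 ler_pdivrMr// mul1r ler_nat.
  - by rewrite nnegrE expR_ge0.
  apply: le_trans (expR_ge1Dx _); rewrite lerD2l lerN2.
  by rewrite ler_pdivlMr// mulrC ler_pdivrMr// mulrC.
have : 1 <= tau * expR (- (n%:R / rho)).
  by apply: (le_trans H2); rewrite ler_pM2l.
rewrite expRN -[X in X * _](@lnK _ tau) ?posrE// -expRN -expRD.
rewrite -[X in X <= _]expR0 ler_expR subr_ge0 ler_pdivrMr// mulrC.
move=> /(lt_le_trans hn).
by rewrite ltxx.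
Qed.

(** * Counting lattice points in balls *)

(** This is all that the counting uses in place of volume: a subgroup with enumerable finite balls,
    a covering radius, and polynomial growth, the only field where [d] enters. *)
Record lattice (R : realType) (X : normedModType R) (d : nat) := Lattice {
  lat :> X -> Prop ;
  lat0 : lat 0 ;
  latB : forall x y, lat x -> lat y -> lat (x - y) ;
  lball : R -> seq X ;
  lball_uniq : forall r, uniq (lball r) ;
  mem_lball : forall r x, x \in lball r <-> lat x /\ `|x| <= r ;
  lradius : R ;
  lradiusP : forall x, exists2 y, lat y & `|x - y| <= lradius ;
  lgrowth : R ;
  lgrowthP : forall r, 0 <= r ->
    (size (lball r))%:R <= lgrowth * (1 + r) ^+ d }.

Section LatticeCounting.
Variables (R : realType) (X : normedModType R) (d : nat) (L : lattice X d).

Lemma latD x y : L x -> L y -> L (x + y).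
Proof.
move=> Lx Ly; rewrite -[y]opprK; apply: latB => //.
by rewrite -sub0r; apply: latB => //; exact: lat0.
Qed.

(* If the ball count were multiplied by more than [2 q ^ d] at every dilation
   by [q], it would outgrow the bound [lgrowth * (1 + r) ^ d]. *)
Lemma good_scale (q r0 : R) : 1 < q -> 1 <= r0 ->
  exists2 r, r0 <= r &
    (size (lball L (q * r)))%:R <= 2 * q ^+ d * (size (lball L r))%:R.
Proof.
move=> q1 r1; apply: contrapT => H.
have {}H r : r0 <= r ->
    2 * q ^+ d * (size (lball L r))%:R < (size (lball L (q * r)))%:R.
  by move=> rr; rewrite ltNge; apply/negP => K; apply: H; exists r.
have q0 : 0 < q by lra.
have qn1 n : 1 <= q ^+ n by rewrite exprn_ege1// ltW.
have lb n : (2 * q ^+ d) ^+ n <= (size (lball L (q ^+ n * r0)))%:R.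
  elim: n => [|n IH].
    rewrite !expr0 mul1r ler1n.
    suff : (0 : X) \in lball L r0 by case: (lball L r0).
    by apply/mem_lball; split; [exact: lat0|rewrite normr0; lra].
  rewrite exprS [q ^+ n.+1]exprS -(mulrA q).
  apply: le_trans (ltW (H (q ^+ n * r0) _)).
    by rewrite ler_pM2l// mulr_gt0// exprn_gt0.
  by rewrite -{1}[r0]mul1r ler_pM2r//; lra.
(* Since [q ^+ n * r0 >= 1], the growth bound absorbs the summand 1 by doubling [r0]; cancelling
   [q ^+ (n * d)] leaves [2 ^+ n <= C] for all [n]. *)
pose C := lgrowth L * (2 * r0) ^+ d.
have ub n : (2 : R) ^+ n <= C.
  have r0n : 0 <= q ^+ n * r0 by rewrite mulr_ge0 ?(le_trans _ (qn1 n))//; lra.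
  have g0 : 0 <= lgrowth L.
    have := le_trans (ler0n R _) (lgrowthP L (lexx 0)).
    by rewrite addr0 expr1n mulr1.
  have : (2 * q ^+ d) ^+ n <= lgrowth L * (q ^+ n * (2 * r0)) ^+ d.
    apply: (le_trans (lb n)); apply: (le_trans (lgrowthP L r0n)).
    apply: ler_wpM2l => //; apply: lerXn2r.
    - by rewrite nnegrE; lra.
    - by rewrite nnegrE mulrCA; lra.
    have : 1 <= q ^+ n * r0 by rewrite mulr_ege1.
    lra.
  move=> K; rewrite -(ler_pM2r (exprn_gt0 (n * d) q0)).
  have -> : 2 ^+ n * q ^+ (n * d) = (2 * q ^+ d) ^+ n.
    by rewrite exprMn -exprM mulnC.
  have -> // : C * q ^+ (n * d) = lgrowth L * (q ^+ n * (2 * r0)) ^+ d.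
  by rewrite /C (exprMn _ (q ^+ n)) -exprM -mulrA; congr (_ * _); exact: mulrC.
have := ub (Num.truncn C); apply/negP; rewrite -ltNge.
apply: lt_le_trans (truncnS_gt C) _.
by rewrite -natrX ler_nat ltn_expl.
Qed.

(** Packing: the translates by [f x] of the lattice ball of radius [s] are disjoint, as a common
    point would put two centres within [2 s], and all lie in the ball of radius [t]. *)
Lemma size_separated_lball (S : seq X) (f : X -> X) (s t : R) : uniq S ->
  (forall x, x \in S -> L (f x) /\ `|f x| + s <= t) ->
  (forall x y, x \in S -> y \in S -> `|f x - f y| <= 2 * s -> x = y) ->
  (size S * size (lball L s) <= size (lball L t))%N.
Proof.
move=> uS Lf sep; rewrite -(size_allpairs (fun x v => f x + v)).
apply: uniq_leq_size.
  apply: allpairs_uniq => //; first exact: lball_uniq.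
  move=> ? ? /allpairsP[[x v]/= [xS /mem_lball[_ vs] ->]].
  move=> /allpairsP[[y w]/= [yS /mem_lball[_ ws] ->]] /= e.
  have exy : x = y.
    apply: sep => //; have -> : f x - f y = w - v.
      by apply/eqP; rewrite subr_eq addrAC eq_sym subr_eq eq_sym addrC e addrC.
    by rewrite (le_trans (ler_normB _ _))//; lra.
  by move: e; rewrite exy => /addrI ->.
move=> z /allpairsP[[x v]/= [xS /mem_lball[Lv vs] ->]].
have [Lfx fxt] := Lf _ xS; apply/mem_lball; split; first exact: latD.
by rewrite (le_trans (ler_normD _ _))// (le_trans _ fxt)// lerD2l.
Qed.

Definition lround (x : X) : X := sval (cid2 (lradiusP L x)).

Lemma lroundL x : L (lround x).
Proof. by rewrite /lround; case: cid2. Qed.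

Lemma lround_dist x : `|x - lround x| <= lradius L.
Proof. by rewrite /lround; case: cid2. Qed.

(* At scale [8 s], rounding moves points by at most [s], so the balls of radius
   [s] around the rounded points are disjoint and lie in the ball of radius
   [10 s]. *)
Lemma half_separated_size (S : seq X) : uniq S ->
  (forall x, x \in S -> `|x| <= 1) ->
  (forall x y, x \in S -> y \in S -> x != y -> 2^-1 < `|x - y|) ->
  (size S)%:R <= 2 * 10 ^+ d :> R.
Proof.
move=> uS S1 sep.
have [||s] := @good_scale 10 (Num.max 1 (lradius L)).
- lra.
- by rewrite le_max lexx.
rewrite ge_max => /andP[s1 sD] hs.
have rd x : `|(8 * s) *: x - lround ((8 * s) *: x)| <= s.
  exact: le_trans (lround_dist _) sD.
have : (size S * size (lball L s) <= size (lball L (10 * s)))%N.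
  apply: (@size_separated_lball S (fun x => lround ((8 * s) *: x))) => //.
    move=> x xS; split; first exact: lroundL.
    have : `|lround ((8 * s) *: x)| <= `|(8 * s) *: x| + s.
      rewrite -lerBlDl (le_trans (lerB_dist _ _))// distrC; exact: rd.
    rewrite normrZ gtr0_norm; last lra.
    have : 8 * s * `|x| <= 8 * s * 1 by rewrite ler_pM2l ?S1//; lra.
    lra.
  move=> x y xS yS xys; apply/eqP; apply: contraT => /(sep _ _ xS yS).
  set x' := lround _ in xys; set y' := lround _ in xys.
  (* Separation by more than 1/2 becomes more than [4 s] at scale [8 s], contradicting this
     bound. *)
  have : `|(8 * s) *: (x - y)| <= s + 2 * s + s.
    have -> : (8 * s) *: (x - y) =
        ((8 * s) *: x - x') + (x' - y') + - ((8 * s) *: y - y').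
      by rewrite opprB !subrKA scalerBr.
    rewrite (le_trans (ler_normD _ _))// lerD ?normrN//.
    by rewrite (le_trans (ler_normD _ _))// lerD.
  rewrite normrZ gtr0_norm; last lra.
  move=> H1 H2; have : 8 * s * 2^-1 < 8 * s * `|x - y|.
    by rewrite ltr_pM2l//; lra.
  lra.
rewrite -(ler_nat R) natrM => /le_trans/(_ hs).
rewrite ler_pM2r// ltr0n lt0n size_eq0; apply/eqP => b0.
suff : (0 : X) \in lball L s by rewrite b0.
by apply/mem_lball; split; [exact: lat0|rewrite normr0; lra].
Qed.

(** A separated set of maximal size is a net, since a far point could be added to it; the packing
    bound makes the maximum exist. *)
Lemma half_net : exists2 T : seq X, (size T)%:R <= 2 * 10 ^+ d :> R &
  forall x, `|x| <= 1 -> exists2 t, t \in T & `|x - t| <= 2^-1.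
Proof.
pose separated (S : seq X) := [/\ uniq S, (forall x, x \in S -> `|x| <= 1) &
  (forall x y, x \in S -> y \in S -> x != y -> 2^-1 < `|x - y|)].
pose P n := `[< exists2 S, separated S & size S = n >].
have P0 : exists n, P n by exists 0%N; apply/asboolP; exists [::].
have ub n : P n -> (n <= Num.truncn (2 * 10 ^+ d : R))%N.
  move=> /asboolP[S [uS S1 sep] <-].
  by rewrite truncn_ge_nat ?half_separated_size// mulr_ge0// exprn_ge0.
have [n /asboolP[S [uS S1 sep] Sn] nmax] := ex_maxnP P0 ub.
exists S; first exact: half_separated_size.
move=> x x1; apply: contrapT => far.
have {}far t : t \in S -> 2^-1 < `|x - t|.
  by move=> tS; rewrite ltNge; apply/negP => K; apply: far; exists t.
have /nmax : P n.+1.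
  apply/asboolP; exists (x :: S); last by rewrite /= Sn.
  split=> /=.
  - rewrite uS andbT; apply/negP => /far; rewrite subrr normr0; lra.
  - by move=> y; rewrite inE => /orP[/eqP->|/S1].
  move=> y z; rewrite !inE => /orP[/eqP->|yS] /orP[/eqP->|zS].
  - by rewrite eqxx.
  - by move=> _; exact: far.
  - by move=> _; rewrite distrC; exact: far.
  - exact: sep.
by rewrite ltnn.
Qed.

(** A copy of the half net, scaled by [2^-1 ^+ j], refines the ball around each point of the
    previous net. *)
Lemma dyadic_net j : exists2 T : seq X, (size T)%:R <= (2 * 10 ^+ d) ^+ j :> R &
  forall x, `|x| <= 1 -> exists2 t, t \in T & `|x - t| <= 2^-1 ^+ j.
Proof.
elim: j => [|j [T sT netT]].
  exists [:: 0]; first by rewrite expr0.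
  by move=> x x1; exists 0; rewrite ?inE// subr0 expr0.
have [H sH netH] := half_net.
exists [seq t + (2^-1 ^+ j) *: h | t <- T, h <- H].
  by rewrite size_allpairs natrM exprSr ler_pM.
have e0 : 0 < 2^-1 ^+ j :> R by rewrite exprn_gt0//; lra.
move=> x /netT[t tT xt].
have [|h hH yh] := netH ((2^-1 ^+ j)^-1 *: (x - t)).
  by rewrite normrZ gtr0_norm ?invr_gt0// mulrC ler_pdivrMr// mul1r.
exists (t + (2^-1 ^+ j) *: h).
  by apply/allpairsP; exists (t, h).
have -> : x - (t + 2^-1 ^+ j *: h) =
    2^-1 ^+ j *: ((2^-1 ^+ j)^-1 *: (x - t) - h).
  by rewrite scalerBr scalerA mulfV ?gt_eqF// scale1r opprD addrA.
by rewrite normrZ gtr0_norm// exprSr ler_pM2l.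
Qed.

(** After dilation by [r = s / mu], balls of radius [mu] have radius [s]. The rounded net points are
    covered greedily by such balls with lattice centres of norm at most [q * s]; [good_scale] bounds
    the ratio of the two lattice counts. The final radius adds to [mu] one net error and one
    rounding error. *)
Lemma ball_cover_of_net (mu eps tau : R) (ts : seq X) (n : nat) :
  0 < mu -> 0 < eps ->
  (forall x, `|x| <= 1 -> exists2 t, t \in ts & `|x - t| <= eps) ->
  (size ts)%:R <= tau ->
  2 * ((1 + 2 * eps + mu) / mu) ^+ d * ln tau < n%:R ->
  exists2 Q : seq X, (size Q <= n)%N &
    forall x, `|x| <= 1 -> exists2 c, c \in Q & `|x - c| <= mu + 2 * eps.
Proof.
move=> mu0 e0 net sts hn; set q := (_ / mu) in hn.
(* This lower bound on the scale makes the rounding error at most [eps * r]. *)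
have [||s] := @good_scale q (Num.max 1 (lradius L * mu / eps)).
- by rewrite /q ltr_pdivlMr//; lra.
- by rewrite le_max lexx.
rewrite ge_max => /andP[s1 sD] hs.
pose r := s / mu.
have r0 : 0 < r by rewrite divr_gt0//; lra.
have rs : mu * r = s by rewrite mulrC divfK// gt_eqF.
have Dr : lradius L <= eps * r.
  by rewrite /r mulrA ler_pdivlMr// [eps * s]mulrC -ler_pdivrMr.
have qs : q * s = (1 + 2 * eps + mu) * r.
  by rewrite -rs /q; field; rewrite gt_eqF.
(* Net points serving the unit ball survive this filter. Their rounded images have norm at most
   [(1 + 2 eps) r], so all lattice points within [s] of them are candidates. *)
pose ts' := [seq t <- ts | `|t| <= 1 + eps].
pose cov (t p : X) := `|lround (r *: t) - p| <= s.
have := @greedy_cover R _ _ ts' (lball L (q * s)) cov (size (lball L s)) n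
  (2 * q ^+ d) tau.
case=> //.
- rewrite lt0n size_eq0; apply/eqP => b0.
  suff : (0 : X) \in lball L s by rewrite b0.
  by apply/mem_lball; split; [exact: lat0|rewrite normr0; lra].
- move=> t; rewrite mem_filter => /andP[t1 _].
  rewrite -size_filter -(size_map (fun v => lround (r *: t) + v)).
  apply: uniq_leq_size.
    by rewrite map_inj_uniq ?lball_uniq//; exact: addrI.
  move=> _ /mapP[v /mem_lball[Lv vs] ->]; rewrite mem_filter /cov.
  rewrite opprD addrA subrr sub0r normrN vs/=.
  apply/mem_lball; split; first by apply: latD => //; exact: lroundL.
  rewrite (le_trans (ler_normD _ _))// qs mulrDl rs lerD//.
  have : `|lround (r *: t)| <= `|r *: t| + eps * r.
    rewrite -lerBlDl (le_trans (lerB_dist _ _))// distrC.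
    exact: le_trans (lround_dist _) Dr.
  rewrite normrZ gtr0_norm//.
  have : r * `|t| <= r * (1 + eps) by rewrite ler_pM2l.
  lra.
- by rewrite mulr_gt0// exprn_gt0// /q divr_gt0//; lra.
- by apply: le_trans sts; rewrite ler_nat size_filter count_size.
move=> Q sQ hQ; exists [seq r^-1 *: c | c <- Q]; first by rewrite size_map.
move=> x x1; have [t tts xt] := net _ x1.
have /hQ/hasP[p pQ tp] : t \in ts'.
  rewrite mem_filter tts andbT -[t](subKr x).
  by rewrite (le_trans (ler_normB _ _))// lerD.
exists (r^-1 *: p); first by apply/mapP; exists p.
rewrite -(ler_pM2l r0) -{1}(gtr0_norm r0) -normrZ.
have -> : r *: (x - r^-1 *: p) = r *: (x - t) +
    (r *: t - lround (r *: t)) + (lround (r *: t) - p).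
  by rewrite !scalerBr !subrKA scalerA mulfV ?gt_eqF// scale1r.
rewrite (le_trans (ler_normD _ _))//.
have H1 : `|r *: t - lround (r *: t)| <= eps * r.
  exact: le_trans (lround_dist _) Dr.
have H2 : `|r *: (x - t)| <= r * eps.
  by rewrite normrZ gtr0_norm// ler_pM2l.
have := ler_normD (r *: (x - t)) (r *: t - lround (r *: t)).
move: tp; rewrite /cov; lra.
Qed.

End LatticeCounting.

(** * The integer lattice of a basis *)

Section BasisLattice.
Variables (R : realType) (X : normedVectType R).
Local Notation n := (\dim {:X}).
Local Notation e := (vbasis {:X}).

Lemma coord_fullv (x : X) : x = \sum_(i < n) coord e i x *: e`_i.
Proof. by apply: coord_vbasis; rewrite memvf. Qed.

Lemma coord_lin_comb (a : 'I_n -> R) i :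
  coord e i (\sum_(j < n) a j *: e`_j) = a i.
Proof. by apply: coord_sum_free; exact: basis_free (vbasisP _). Qed.

Lemma entry_le_norm (v : 'rV[R]_n) i : `|v 0 i| <= `|v|.
Proof.
rewrite [leRHS]/Num.norm /= mx_normrE; apply/bigmax_geP; right => /=.
by exists (0, i).
Qed.

(** The norm of a combination of the basis is continuous in the coefficients and, by freeness,
    positive on the compact unit sphere of the sup norm; [M] is the inverse of its minimum there. *)
Lemma coord_bounded : exists2 M : R, 0 <= M &
  forall x i, `|coord e i x| <= M * `|x|.
Proof.
pose f (v : 'rV[R]_n) : R := `|\sum_(i < n) v 0 i *: e`_i|.
pose A : set 'rV[R]_n := [set v | `|v| = 1].
have fc : continuous f.
  move=> v; apply: (@cvg_norm R X _ _ (nbhs_filter v)).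
  apply: cvg_big => [|i _]; first exact: add_continuous.
  by apply: cvgZr_tmp; exact: coord_continuous.
have cA : compact A.
  apply: bounded_closed_compact.
    by exists 1; split => // M M1 v /= ->; exact: ltW.
  have /continuous_closedP/(_ [set 1]) := @norm_continuous R 'rV[R]_n.
  by apply; exact: closed_eq.
have scal x (v : 'rV[R]_n) : v = \row_i coord e i x -> f v = `|x|.
  move=> ->; rewrite /f [in RHS](coord_fullv x); congr (`| _ |).
  by apply: eq_bigr => i _; rewrite mxE.
(* The sphere is empty only in dimension 0, where there is no coordinate to bound. *)
have [A0|A0] := pselect (A !=set0); last first.
  exists 0 => // x i; rewrite mul0r.
  pose v := \row_i coord e i x : 'rV[R]_n.
  have [v0|v0] := eqVneq v 0.
    by move/rowP: v0 => /(_ i); rewrite !mxE => ->; rewrite normr0.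
  exfalso; apply: A0; exists (`|v|^-1 *: v).
  by rewrite /A /= normrZ normfV normr_id mulVf// normr_eq0.
have [c /set_mem cA1 cmin] := EVT_min_rV A0 cA (continuous_subspaceT fc).
have fc0 : 0 < f c.
  rewrite lt_def normr_ge0 andbT normr_eq0; apply/eqP => s0.
  have c0 : c = 0.
    by apply/rowP => i; rewrite -(coord_lin_comb (c 0)) s0 linear0 mxE.
  by move: cA1; rewrite /A /= c0 normr0 => /eqP; rewrite eq_sym oner_eq0.
exists (f c)^-1 => [|x i]; first by rewrite invr_ge0 ltW.
pose v := \row_i coord e i x : 'rV[R]_n.
have vi : `|coord e i x| <= `|v|.
  by have := entry_le_norm v i; rewrite mxE.
apply: (le_trans vi); rewrite -(scal x v)// mulrC ler_pdivlMr//.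
have [->|v0] := eqVneq v 0; first by rewrite normr0 mul0r normr_ge0.
have nv0 : 0 < `|v| by rewrite normr_gt0.
have /cmin : `|v|^-1 *: v \in A.
  by rewrite inE /A /= normrZ normfV normr_id mulVf// normr_eq0.
have -> : f (`|v|^-1 *: v) = `|v|^-1 * f v.
  rewrite /f -[X in _ = X * _](@gtr0_norm _ `|v|^-1) ?invr_gt0// -normrZ.
  rewrite scaler_sumr.
  by congr (`| _ |); apply: eq_bigr => j _; rewrite mxE scalerA.
by rewrite ler_pdivlMl// mulrC.
Qed.

Definition int_coord (x : X) := forall i, coord e i x \is a Num.int.

(** The shift by [m] turns the [2 m + 1] ordinals into the integers from [- m] to [m]. *)
Definition box_points (m : nat) : seq X :=
  [seq \sum_(i < n) ((z i)%:R - m%:R) *: e`_i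
     | z : {ffun 'I_n -> 'I_(m.*2.+1)}].

Lemma box_points_int_coord m x : x \in box_points m -> int_coord x.
Proof.
by move=> /mapP[z _ ->] i; rewrite coord_lin_comb rpredB// natr_int.
Qed.

Lemma mem_box_points m x : int_coord x ->
  (forall i, `|coord e i x| <= m%:R) -> x \in box_points m.
Proof.
move=> xint xm.
have zP i : exists z : 'I_(m.*2.+1), coord e i x = z%:R - m%:R.
  have /intrP[a ea] := xint i; have := xm i.
  rewrite ea -intr_norm -[m%:R]/(m%:~R) ler_int => am.
  have am' : (absz (a + m%:Z)%R < m.*2.+1)%N by lia.
  exists (Ordinal am') => /=; rewrite natr_absz ger0_norm ?intrD ?addrK//.
  lia.
pose z := [ffun i => sval (cid (zP i))].
apply/mapP; exists z; first by rewrite mem_enum.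
rewrite [LHS]coord_fullv; apply: eq_bigr => i _.
by rewrite ffunE; case: cid => ? /= <-.
Qed.

Lemma size_box_points m : size (box_points m) = (m.*2.+1 ^ n)%N.
Proof. by rewrite size_map -cardE card_ffun !card_ord. Qed.

(** [coord_bounded] places a ball of radius [r] in a box with at most
    [2 M r + 3 <= (2 M + 3) (1 + r)] integers per side. Taking floors of coordinates gives the
    covering radius. *)
Lemma basis_lattice : lattice X n.
Proof.
have [M M0 hM] := cid2 coord_bounded.
pose ball (r : R) : seq X :=
  undup [seq x <- box_points (Num.truncn (M * r)).+1 | `|x| <= r].
apply: (@Lattice R X n int_coord _ _ ball _ _
  (\sum_(i < n) `|e`_i|) _ ((2 * M + 3) ^+ n)).
- by move=> i; rewrite linear0 rpred0.
- by move=> x y xi yi i; rewrite linearB; apply: rpredB; [exact: xi|exact: yi].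
- by move=> r; exact: undup_uniq.
- move=> r x; rewrite mem_undup mem_filter; split.
    by move=> /andP[-> /box_points_int_coord].
  move=> [xi xr]; rewrite xr /=; apply: mem_box_points => // i.
  apply: le_trans (ltW (truncnS_gt _)).
  by apply: (le_trans (hM x i)); rewrite ler_wpM2l.
- move=> x; exists (\sum_(i < n) (Num.floor (coord e i x))%:~R *: e`_i).
    by move=> i; rewrite coord_lin_comb intr_int.
  rewrite {1}[x]coord_fullv -sumrB (le_trans (ler_norm_sum _ _ _))//.
  apply: ler_sum => i _; rewrite -scalerBl normrZ ler_piMl//.
  have /andP[f1 f2] := floor_itv (coord e i x).
  rewrite ger0_norm ?subr_ge0// lerBlDl ltW//; move: f2.
  by rewrite intrD.
move=> r r0; rewrite -exprMn.
apply: (@le_trans _ _ ((Num.truncn (M * r)).+1.*2.+1 ^ n)%:R).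
  rewrite ler_nat (leq_trans (size_undup _))// size_filter.
  by rewrite (leq_trans (count_size _ _))// size_box_points.
rewrite natrX; apply: lerXn2r.
- by rewrite nnegrE.
- by rewrite nnegrE mulr_ge0//; lra.
have Mr : 0 <= M * r by rewrite mulr_ge0.
have := truncn_le (M * r); rewrite Mr => tM.
rewrite -[X in X <= _]natr1 -muln2 natrM -natr1.
have -> : (2 * M + 3) * (1 + r) = 2 * (M * r) + 2 * M + 3 * r + 3 by ring.
lra.
Qed.

End BasisLattice.

(** * The covering number and the theorem *)

Lemma expR_half_le2 (R : realType) : expR (2^-1) <= 2 :> R.
Proof.
have := expR_ge1Dx (- 2^-1 : R); rewrite expRN.
have e0 : 0 < expR (2^-1 : R) := expR_gt0 _.
rewrite -(ler_pM2l e0) mulfV ?gt_eqF//; lra.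
Qed.

Lemma ln10_le4 (R : realType) : ln 10 <= 4 :> R.
Proof.
have ln2 : ln 2 <= 1 :> R.
  by have := @le_ln1Dx R 1; rewrite -natr1; apply; lra.
apply: (@le_trans _ _ (ln (2 ^+ 4))).
  by rewrite ler_ln ?posrE// -natrX ler_nat.
by rewrite lnXn// -(mulr_natl (ln 2)); lra.
Qed.

Lemma ln_net_size_le (R : realType) (d j : nat) :
  ln ((2 * 10 ^+ d) ^+ j) <= j%:R * (4 * d%:R + 1) :> R.
Proof.
have p10 : 0 < 10 ^+ d :> R by rewrite exprn_gt0.
rewrite lnXn ?mulr_gt0// -(mulr_natl (ln _)) ler_wpM2l// lnM ?posrE// lnXn//.
have ln2 : ln 2 <= 1 :> R.
  by have := @le_ln1Dx R 1; rewrite -natr1; apply; lra.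
rewrite -(mulr_natl (ln 10)) addrC lerD// mulrC ler_wpM2r//.
exact: ln10_le4.
Qed.

(** The choice of [eps] gives [64 eps d <= 1], so replacing the limit ratio 5 by the actual one
    costs a factor at most [exp (14 eps d) <= exp (1/2) <= 2]. *)
Lemma cover_ratio_le (R : realType) (d : nat) (eps : R) :
  eps = 2^-1 ^+ (d + 6) ->
  ((1 + 2 * eps + (4^-1 - 3 * eps)) / (4^-1 - 3 * eps)) ^+ d <= 2 * 5 ^+ d.
Proof.
move=> epsE.
have e0 : 0 < eps by rewrite epsE exprn_gt0//; lra.
have ed : 64 * (eps * d%:R) <= 1.
  have -> : 64 * (eps * d%:R) = d%:R / 2 ^+ d.
    by rewrite epsE exprD exprVn; field; rewrite expf_neq0.
  by rewrite ler_pdivrMr ?exprn_gt0// mul1r -natrX ler_nat ltnW// ltn_expl.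
have e64 : 64 * eps <= 1.
  rewrite epsE exprD; have : 2^-1 ^+ d <= 1 :> R by rewrite exprn_ile1//; lra.
  lra.
have den0 : 0 < 4^-1 - 3 * eps by lra.
(* The first-order coefficient is 56/5; 14 leaves room for the quadratic term. *)
apply: (@le_trans _ _ ((5 * (1 + 14 * eps)) ^+ d)).
  apply: lerXn2r.
  - by rewrite nnegrE divr_ge0//; lra.
  - by rewrite nnegrE; lra.
  rewrite ler_pdivrMr//; have : eps * (64 * eps) <= eps * 1 by rewrite ler_pM2l.
  lra.
rewrite exprMn mulrC ler_pM2r ?exprn_gt0//.
apply: (le_trans _ (expR_half_le2 R)).
apply: (@le_trans _ _ (expR (14 * eps) ^+ d)).
  apply: lerXn2r; rewrite ?nnegrE ?expR_ge0 ?expR_ge1Dx//; lra.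
rewrite -expRM_natl ler_expR; lra.
Qed.

(** Twice the bound [2 * 5 ^+ d] on the ratio, times the bound on the logarithm of the size of the
    dyadic net at level [d + 6]. *)
Definition cover_size (R : realType) (d : nat) : R :=
  4 * 5 ^+ d * ((d + 6)%:R * (4 * d%:R + 1)).

(** With [mu = 1/4 - 3 eps], the loss of [2 eps] leaves the radius [1/4 - eps], strictly below 1/4.
    An exponentially fine net is affordable because only its logarithm enters. *)
Lemma ball_cover (R : realType) (X : normedVectType R) (N : nat) :
  cover_size R (\dim {:X}) < N%:R ->
  exists2 Q : seq X, (size Q <= N)%N & exists2 l : R, l < 4^-1 &
    forall x : X, `|x| <= 1 -> exists2 c, c \in Q & `|x - c| <= l.
Proof.
set d := \dim _ => hN.
pose eps : R := 2^-1 ^+ (d + 6).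
have e0 : 0 < eps by rewrite exprn_gt0//; lra.
have e64 : 64 * eps <= 1.
  rewrite /eps exprD; have : 2^-1 ^+ d <= 1 :> R by rewrite exprn_ile1//; lra.
  lra.
have [T sT netT] := dyadic_net (basis_lattice X) (d + 6).
have mu0 : 0 < 4^-1 - 3 * eps by lra.
have [|Q sQ covQ] := @ball_cover_of_net _ _ _ (basis_lattice X)
  _ _ _ T N mu0 e0 netT sT.
  apply: le_lt_trans hN.
  have -> : cover_size R d = 2 * (2 * 5 ^+ d) * ((d + 6)%:R * (4 * d%:R + 1)).
    by rewrite /cover_size; ring.
  apply: ler_pM.
  - by rewrite mulr_ge0// exprn_ge0// divr_ge0//; lra.
  - by rewrite ln_ge0// exprn_ege1// mulr_ege1 ?ler1n// exprn_ege1 ?ler1n.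
  - by rewrite ler_pM2l// cover_ratio_le.
  - exact: ln_net_size_le.
exists Q => //; exists (4^-1 - 3 * eps + 2 * eps); first lra.
exact: covQ.
Qed.

Lemma k_distance_set_card (R : realType) (X : normedVectType R) (k N : nat)
    (S : set X) :
  cover_size R (\dim {:X}) < N%:R -> k_distance_set k S ->
  (S #<= `I_(k.+1 ^ N))%card.
Proof.
move=> /ball_cover[Q sQ [l l4 covQ]] kS.
have sub (B : {fset X}) : [set` B] `<=` S -> (#|` B| <= k.+1 ^ N)%N.
  move=> BS; have fD : finite_set (distances S).
    by apply/finite_set_leP; exists k.
  (* If [Q] has fewer than [N] entries, the missing centres are padded with 0. *)
  apply: (@k_distance_seq_size R X k N l (fun i => nth 0 Q i) B
    (fset_set (distances S)) l4).
  - move=> u u1; have [|c cQ uc] := covQ u; first by rewrite u1.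
    have iN : (index c Q < N)%N by rewrite (leq_trans _ sQ)// index_mem.
    by exists (Ordinal iN); rewrite /= nth_index.
  - exact: geq_card_fset_set.
  - exact: fset_uniq.
  - move=> x y xB yB xy; rewrite in_fset_set// inE.
    by exists x, y; split => //; [exact: BS|exact: BS|exact/eqP].
have [fS|iS] := pselect (finite_set S).
  have := sub (fset_set S); rewrite fset_setK// => /(_ (@subset_refl _ _)) c.
  have [n Sn] := fS.
  move: (c); rewrite (card_fset_set Sn) => nM.
  by rewrite (card_le_eql Sn) card_le_II.
(* An infinite [S] would contain a finite subset exceeding the bound. *)
have [B BS] := infinite_set_fset (k.+1 ^ N).+1 iS.
by move=> /leq_trans/(_ (sub _ BS)); rewrite ltnn.
Qed.

Lemma max_k_distance_exists (R : realType) (X : normedVectType R) (k M : nat) :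
  (forall S : set X, k_distance_set k S -> (S #<= `I_M)%card) ->
  exists2 m, is_max_k_distance X k m & (m <= M)%N.
Proof.
move=> bound.
pose P m := `[< exists2 S : set X, k_distance_set k S & (S #= `I_m)%card >].
have P0 : exists m, P m.
  exists 0%N; apply/asboolP; exists set0; last by rewrite II0.
  rewrite /k_distance_set (_ : distances _ = set0) ?card_le0//.
  by apply/seteqP; split => // r [x [y []]].
have PM m : P m -> (m <= M)%N.
  move=> /asboolP[S kS Sm]; rewrite -card_le_II -(card_le_eql Sm).
  exact: bound.
have [m Pm mmax] := ex_maxnP P0 PM.
exists m; last exact: PM.
split; first by move/asboolP: Pm => [S kS Sm]; exists S.
move=> S kS.
have [n Sn] : finite_set S by apply/finite_set_leP; exists M; exact: bound.
by rewrite (card_le_eql Sn) card_le_II mmax//; apply/asboolP; exists S.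
Qed.

(** With [s] the square root of [d], the polynomial factor is at most
    [32 (2 + s) ^ 4 + 1 <= (2 + s) ^ 10], and [2 + s <= exp (1 + s) <= 5 ^ (1 + s)]. *)
Lemma cover_size_bound (R : realType) (d : nat) :
  cover_size R d + 1 <= 5 `^ (d%:R + 10 * (1 + Num.sqrt d%:R)).
Proof.
set s := Num.sqrt _.
have s0 : 0 <= s by rewrite sqrtr_ge0.
have sd : s * s = d%:R by rewrite -expr2 sqr_sqrtr.
rewrite powRD ?pnatr_eq0 ?implybT// powR_mulrn//.
have p5 : 1 <= 5 ^+ d :> R by rewrite exprn_ege1// ler1n.
have ln5 : 1 <= ln 5 :> R.
  rewrite -ler_expR lnK ?posrE//.
  have -> : 1 = 2^-1 + 2^-1 :> R by lra.
  rewrite expRD; have := expR_half_le2 R; have := expR_ge0 (2^-1 : R).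
  move=> a b; have : expR 2^-1 * expR 2^-1 <= 2 * 2 :> R by rewrite ler_pM.
  lra.
have pw : (2 + s) ^+ 10 <= 5 `^ (10 * (1 + s)).
  rewrite /powR pnatr_eq0/=; apply: (@le_trans _ _ (expR (10 * (1 + s)))).
    rewrite expRM_natl; apply: lerXn2r; rewrite ?nnegrE ?expR_ge0//; first lra.
    by apply: le_trans (expR_ge1Dx _); rewrite addrA.
  by rewrite ler_expR ler_peMr// mulr_ge0//; lra.
have p5' : 0 < 5 ^+ d :> R by rewrite (lt_le_trans _ p5).
apply: (@le_trans _ _ (5 ^+ d * (2 + s) ^+ 10)); last by rewrite ler_pM2l.
have t1 : 1 <= (2 + s) ^+ 4 by rewrite exprn_ege1//; lra.
have t2 : 2 ^+ 6 <= (2 + s) ^+ 6 by apply: lerXn2r; rewrite ?nnegrE; lra.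
have t3 : (d + 6)%:R * (4 * d%:R + 1) <= 8 * (2 + s) ^+ 4.
  have -> : 8 * (2 + s) ^+ 4 =
      (2 * ((2 + s) * (2 + s))) * (4 * ((2 + s) * (2 + s))) by ring.
  have ss : 0 <= s * s by rewrite mulr_ge0.
  rewrite natrD -sd; apply: ler_pM; lra.
rewrite (_ : 10 = 4 + 6)%N// [(2 + s) ^+ _]exprD.
have t4 : (2 + s) ^+ 4 * 2 ^+ 6 <= (2 + s) ^+ 4 * (2 + s) ^+ 6.
  by rewrite ler_pM2l// (lt_le_trans _ t1).
apply: (@le_trans _ _ (5 ^+ d * (32 * (2 + s) ^+ 4 + 1))).
  rewrite mulrDr mulr1 lerD// /cover_size -mulrA mulrCA ler_pM2l//.
  lra.
rewrite ler_pM2l//; apply: le_trans t4; lra.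
Qed.

Lemma cover_exponent_littleo (R : realType) :
  (10 * (1 + Num.sqrt d%:R)) / d%:R @[d --> \oo] --> (0 : R).
Proof.
apply/cvgr0Pnorm_le => e e0.
(* For [d >= 1] the quotient is at most 20 over the square root of [d]. *)
exists (Num.truncn ((20 / e) ^+ 2)).+1 => // d /= dN.
have d0 : 0 < d%:R :> R by rewrite ltr0n (leq_trans _ dN).
have d1 : 1 <= Num.sqrt d%:R :> R.
  by rewrite -[X in X <= _]sqrtr1 ler_sqrt// ler1n (leq_trans _ dN).
have ds : 20 / e <= Num.sqrt d%:R.
  have e20 : 0 <= 20 / e by rewrite divr_ge0// ltW.
  rewrite -(ger0_norm e20) -sqrtr_sqr ler_sqrt//.
  by rewrite (le_trans (ltW (truncnS_gt _)))// ler_nat.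
rewrite ger0_norm; last by rewrite divr_ge0// mulr_ge0// addr_ge0// sqrtr_ge0.
rewrite ler_pdivrMr//.
have -> : e * d%:R = e * Num.sqrt d%:R * Num.sqrt d%:R.
  by rewrite -mulrA -expr2 sqr_sqrtr.
have : 20 * Num.sqrt d%:R <= e * Num.sqrt d%:R * Num.sqrt d%:R.
  by rewrite ler_pM2r ?(lt_le_trans _ d1)// mulrC -ler_pdivrMr.
lra.
Qed.

Theorem theorem29 (R : realType) :
  exists2 o : nat -> R, o d / d%:R @[d --> \oo] --> (0 : R) &
    forall (d : nat) (X : normedVectType R) (k : nat),
      \dim {:X} = d -> (0 < k)%N ->
      exists2 m : nat, is_max_k_distance X k m &
        m%:R <= k.+1%:R `^ (5 `^ (d%:R + o d)).
Proof.
exists (fun d => 10 * (1 + Num.sqrt d%:R)); first exact: cover_exponent_littleo.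
move=> d X k dX _.
pose N := (Num.truncn (cover_size R d)).+1.
have dN : cover_size R (\dim {:X}) < N%:R by rewrite dX truncnS_gt.
have bound (S : set X) : k_distance_set k S -> (S #<= `I_(k.+1 ^ N))%card.
  exact: k_distance_set_card.
have [m mmax mM] := max_k_distance_exists bound.
exists m => //; apply: (@le_trans _ _ (k.+1 ^ N)%:R); first by rewrite ler_nat.
rewrite natrX -powR_mulrn// ler_powR ?ler1n//.
(* Rounding up to the integer [N] costs at most the summand 1 in [cover_size_bound]. *)
apply: le_trans (cover_size_bound R d); rewrite /N -natr1 lerD2r.
by rewrite truncn_le // /cover_size !mulr_ge0// ?exprn_ge0 ?addr_ge0.
Qed.
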